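(* Let $G_1$ be a finite connected oriented graph with distinguished vertices $a_1,b_1$ such that $d_1(a_1,b_1)>1$ and there exist at least two edge-disjoint paths connecting $a_1$ to $b_1$ in $G_1$. Let $f=f_1$ and $f_k$ be the crossing probability functions of the hierarchical graphs $G_k$ with seed $G_1$. Then: (a) $f$ has exactly three fixed points in $[0,1]$, namely $0$, $1$ and some $p_\star=p_\star(G_1)\in(0,1)$. (b) $f'(0)=f'(1)=0$, while $$\zeta:=f'(p_\star)\ \ge\ \Big(1-\tfrac12(1-p_\star)^{\max\{\deg(a_1),\deg(b_1)\}}\Big)^{-1}>1 .$$ (c) $p_\star=\sup\{p\in[0,1]:\ \lim_{k\to\infty} f_k(p)=0\}$.
   Context: $G_1=(V_1,\mathcal E_1)$ is a finite connected oriented graph (a finite simple graph with an orientation chosen for each edge), with two distinguished vertices $a_1,b_1$. Orientations are used only to define the replacement operation below; distances, paths and connectivity ignore orientation. $d_1$ is the graph distance in $G_1$ and $\deg(x)$ is the total degree (in-degree plus out-degree) of $x$ in $G_1$. Hierarchical graphs: $G_0$ is a single oriented edge $(a_0,b_0)$. Given $G_k=(V_k,\mathcal E_k)$ with distinguished vertices $a_k,b_k$, the graph $G_{k+1}$ is obtained by replacing each oriented edge $(x,y)\in\mathcal E_k$ by a fresh copy of $G_1$, with $a_1$ identified with $x$ and $b_1$ with $y$; $a_{k+1},b_{k+1}$ are the vertices that were $a_k,b_k$. Percolation: under $\mathbb P^k_p$ each edge of $G_k$ is independently open with probability $p$ and closed with probability $1-p$. The crossing probability is $f_k(p)=\mathbb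 P^k_p(a_k\leftrightarrow b_k)$, the probability that $a_k$ and $b_k$ are joined by a path of open edges. *)

(* Defs.v *)
From HB Require Import structures.
From mathcomp Require Import all_boot all_order all_algebra.
From mathcomp Require Import all_classical all_reals all_analysis.

Set Implicit Arguments.
Unset Strict Implicit.
Unset Printing Implicit Defensive.

Import Order.TTheory GRing.Theory Num.Theory.
Import numFieldNormedType.Exports.

Local Open Scope ring_scope.

(* Finite oriented graphs with two distinguished vertices. Edges form a type of
   their own; simplicity is the separate predicate [simple_graph]. *)
Record ograph := OGraph {
  vert : finType;
  edge : finType;
  src : edge -> vert;
  tgt : edge -> vert;
  ga : vert;
  gb : vert
}.

Section Graphs.
Variable G : ograph.
Implicit Types (x y : vert G) (e : edge G) (w : {set edge G}).

Definition ends e : {set vert G} := [set src e; tgt e].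

Definition simple_graph : Prop :=
  (forall e, src e != tgt e) /\ injective ends.

(* Adjacency, ignoring orientation, through an edge of w. *)
Definition adj_in w : rel (vert G) :=
  fun x y => [exists e in w, ends e == [set x; y]].

Definition adj : rel (vert G) := adj_in [set: edge G].

Definition connected_graph : Prop := forall x y, connect adj x y.

Definition deg x : nat :=
  (#|[set e | src e == x]| + #|[set e | tgt e == x]|)%N.

(* Least length of a walk from x to y; the default value #|vert G| is only
   reached when y is not connected to x. *)
Definition gdist x y : nat :=
  \big[minn/#|vert G|]_(n < #|vert G| |
    [exists s : n.-tuple (vert G), path adj x s && (last x s == y)]) n.

(* Paths are given by their start x and the sequence s of later vertices. *)
Definition is_path x y (s : seq (vert G)) : Prop :=
  [/\ path adj x s, last x s = y & uniq (x :: s)].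

(* In a simple graph an edge is determined by its pair of endpoints. *)
Definition path_edges x (s : seq (vert G)) : seq {set vert G} :=
  pairmap (fun u v => [set u; v]) x s.

Definition two_edge_disjoint_paths x y : Prop :=
  exists s1 s2, [/\ is_path x y s1, is_path x y s2 &
    [disjoint path_edges x s1 & path_edges x s2]].

(* A percolation configuration is its set of open edges. *)
Definition perc_prob (R : realType) (p : R) (A : {set {set edge G}}) : R :=
  \sum_(w in A) \prod_e (if e \in w then p else 1 - p).

Definition crossing_event : {set {set edge G}} :=
  [set w | connect (adj_in w) (ga G) (gb G)].

Definition crossing_prob (R : realType) (p : R) : R :=
  perc_prob p crossing_event.

End Graphs.

Definition single_edge : ograph :=
  @OGraph bool unit (fun=> false) (fun=> true) false true.

Section Replacement.
Variables G H : ograph.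

Definition interior : finType := {v : vert H | (v != ga H) && (v != gb H)}.

(* The vertex of the new graph that is v in the copy of H replacing e. *)
Definition glue (e : edge G) (v : vert H) : vert G + edge G * interior :=
  if insub v is Some u then inr (e, u)
  else if v == ga H then inl (src e) else inl (tgt e).

Definition replace_edges : ograph :=
  @OGraph (vert G + edge G * interior)%type (edge G * edge H)%type
    (fun d => glue d.1 (src d.2)) (fun d => glue d.1 (tgt d.2))
    (inl (ga G)) (inl (gb G)).

End Replacement.

Fixpoint hier (G1 : ograph) (k : nat) : ograph :=
  if k is k'.+1 then replace_edges (hier G1 k') G1 else single_edge.

(* Main.v *)
Require Import Defs.
From HB Require Import structures.
From mathcomp Require Import all_boot all_order all_algebra.
From mathcomp Require Import all_classical all_reals all_analysis.
From mathcomp Require Import ring lra.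

(** Write f for the crossing probability of the seed, D for the larger degree
of the two distinguished vertices, and pi_e(p) for the probability that the
edge e is pivotal.

The heart of the matter is a sharpening of the Moore-Shannon inequality, valid
for all p in (0,1) ([sharp_moore_shannon]):
  f (1 - f) <= p (1 - p) f' (1 - (1 - p)^D / 2).
By Russo's formula f' is the sum of the pi_e ([russo]). Expand the crossing
indicator in the Walsh basis of the p-biased cube, and call energy of a set S
of edges the squared normalised coefficient on S. The energies of the nonempty
S add up to the variance f (1 - f); weighted by #|S|, they add up to the total
influence p (1 - p) f'; and the singletons carry p (1 - p) sum_e pi_e^2.
Since 2 <= #|S| + [#|S| = 1] for every nonempty S, twice the variance is at
most p (1 - p) sum_e (pi_e + pi_e^2) ([variance_le]). Finally
pi_e <= 1 - (1 - p)^D ([expect_pivotal_le]): the distinguished vertices are at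
distance greater than 1, so e misses one of them, and e is not pivotal as soon
as all the edges at that vertex are closed.

At a fixed point in (0,1) the variance is p (1 - p), and the inequality becomes
the bound on f'. It also says that the odds ratio
f (1 - p) / ((1 - f) p) is strictly increasing ([odds_ratio_incr]); it equals 1
exactly at the interior fixed points, so there is at most one, with f below the
diagonal before it and above after it. An interior fixed point exists by the
intermediate value theorem, because f is flat at the fixed points 0 and 1: a
single open edge does not cross, and a single closed edge does not disconnect
since one of two edge-disjoint paths avoids it.

Replacing edges composes crossing probabilities ([crossing_prob_replace]): each
edge of G becomes an independent block that either crosses or not, and only
that matters for the connection of vertices of G. Hence f_k is the k-th iterate
of f, and the position of f relative to the diagonal decides whether the
iterates tend to 0 ([threshold_sup]). *)

Set Implicit Arguments.
Unset Strict Implicit.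
Unset Printing Implicit Defensive.

Import Order.TTheory GRing.Theory Num.Theory.
Import numFieldNormedType.Exports.

Local Open Scope ring_scope.

(** * Expectation on the biased cube and Russo's formula *)

Definition wt {R : realType} {E : finType} (p : R) (w : {set E}) : R :=
  \prod_e (if e \in w then p else 1 - p).

(** The weight of the edges other than [e]: it is unchanged when [e] is opened
or closed, which is what makes summation over the state of [e] possible. *)
Definition wt_off {R : realType} {E : finType} (e : E) (p : R)
    (w : {set E}) : R :=
  \prod_(i | i != e) (if i \in w then p else 1 - p).

Definition expect {R : realType} {E : finType} (p : R)
    (F : {set E} -> R) : R :=
  \sum_(w : {set E}) wt p w * F w.

Definition discrete_diff {R : realType} {E : finType} (e : E)
    (F : {set E} -> R) (w : {set E}) : R :=
  F (e |: w) - F (w :\ e).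

Lemma neq_set_mem (E : finType) (w w' : {set E}) :
  w != w' -> exists e, (e \in w) != (e \in w').
Proof.
move=> neq; apply/existsP; rewrite -negb_forall; apply: contra neq.
by move=> /forallP eqw; apply/eqP/setP => e; rewrite (eqP (eqw e)).
Qed.

Lemma sum_set_split (V : nmodType) (E : finType) (e : E) (G : {set E} -> V) :
  \sum_w G w = \sum_(w : {set E} | e \notin w) (G (e |: w) + G w).
Proof.
rewrite big_split /= (bigID (fun w : {set E} => e \in w)) /=; congr (_ + _).
rewrite (reindex_onto (fun w => e |: w) (fun w => w :\ e)) /=; last first.
  by move=> w ew; rewrite finset.setD1K.
apply: eq_bigl => w; rewrite finset.setU11 /=.
apply/eqP/idP => [<-|ew]; first by rewrite finset.setD11.
by rewrite finset.setU1K.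
Qed.

Lemma setD1_id (E : finType) (e : E) (w : {set E}) : e \notin w -> w :\ e = w.
Proof. by move=> ew; apply/finset.setDidPl; rewrite disjoint_sym disjoints1. Qed.

Section Expectation.
Variables (R : realType) (E : finType).
Implicit Types (p : R) (e : E) (w S : {set E}) (F : {set E} -> R).

(** Expanding the product over e of p + (1 - p). It holds for every p, so the
identities below remain true outside [0,1]. *)
Lemma sum_wt p : \sum_(w : {set E}) wt p w = 1.
Proof.
rewrite -(bigA_distr _ _ (fun=> p) (fun=> 1 - p)) big1 // => e _.
by rewrite /=; ring.
Qed.

Lemma wt_in e p w : e \notin w -> wt p (e |: w) = p * wt_off e p w.
Proof.
move=> ew; rewrite /wt (bigD1 e) //= finset.setU11; congr (_ * _).
by apply: eq_bigr => i ie; rewrite in_setU1 (negbTE ie).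
Qed.

Lemma wt_out e p w : e \notin w -> wt p w = (1 - p) * wt_off e p w.
Proof. by move=> ew; rewrite /wt (bigD1 e) //= (negbTE ew). Qed.

(** Averaging over the state of [e] alone. The identities of this part and the
next about single edges all reduce to this one. *)
Lemma expect_split e p F :
  expect p F = \sum_(w : {set E} | e \notin w)
    wt_off e p w * (p * F (e |: w) + (1 - p) * F w).
Proof.
rewrite /expect (sum_set_split e); apply: eq_bigr => w ew.
by rewrite (wt_in p ew) (wt_out p ew); ring.
Qed.

Lemma discrete_diff_in e F w :
  e \notin w -> discrete_diff e F (e |: w) = F (e |: w) - F w.
Proof. by move=> ew; rewrite /discrete_diff finset.setUA finset.setUid finset.setU1K. Qed.

Lemma discrete_diff_out e F w :
  e \notin w -> discrete_diff e F w = F (e |: w) - F w.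
Proof. by move=> ew; rewrite /discrete_diff setD1_id. Qed.

Lemma expect_discrete_diff e p F :
  expect p (discrete_diff e F) =
  \sum_(w : {set E} | e \notin w) wt_off e p w * (F (e |: w) - F w).
Proof.
rewrite (expect_split e); apply: eq_bigr => w ew.
by rewrite discrete_diff_in // discrete_diff_out //; ring.
Qed.

End Expectation.

Lemma deriv_prod (A : comNzRingType) (E : finType) (F : E -> {poly A}) :
  (\prod_e F e)^`() = \sum_e (F e)^`() * \prod_(i | i != e) F i.
Proof.
(* Without repetition the condition [i != e] removes exactly one factor. *)
suff H (s : seq E) : uniq s -> (\prod_(e <- s) F e)^`() =
    \sum_(e <- s) (F e)^`() * \prod_(i <- s | i != e) F i.
  exact: H (index_enum_uniq E).
elim: s => [|x s IH] /=; first by rewrite !big_nil derivC.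
move=> /andP[xs us]; rewrite !big_cons derivM IH // eqxx /=; congr (_ + _).
  congr (_ * _); rewrite [LHS]big_seq_cond [RHS]big_seq_cond.
  apply: eq_bigl => i; rewrite andbT; case: (boolP (i \in s)) => //= si.
  by apply/esym/eqP => ix; rewrite -ix si in xs.
rewrite big_distrr /= [LHS]big_seq [RHS]big_seq; apply: eq_bigr => e es.
rewrite big_cons ifT; first by rewrite mulrCA.
by apply/eqP => xe; rewrite xe es in xs.
Qed.

Section Russo.
Variables (R : realType) (E : finType).
Implicit Types (e : E) (w : {set E}) (F : {set E} -> R).

(** The expectation as a polynomial in p, so that its derivative can be computed
algebraically. *)
Definition expect_poly F : {poly R} :=
  \sum_(w : {set E}) (\prod_e (if e \in w then 'X else 1 - 'X)) * (F w)%:P.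

Lemma horner_expect F p : (expect_poly F).[p] = expect p F.
Proof.
rewrite horner_sum; apply: eq_bigr => w _.
rewrite hornerM hornerC horner_prod; congr (_ * _).
by apply: eq_bigr => e _; case: ifP; rewrite !hornerE.
Qed.

(** The derivative of the weight of a configuration is a signed sum, over the
edges e, of the weight off e, with sign + if e is open and - otherwise; pairing
the configurations that differ only at e turns the signs into discrete
differences. *)
Lemma russo F p :
  (expect_poly F)^`().[p] = \sum_e expect p (discrete_diff e F).
Proof.
rewrite raddf_sum /=.
under eq_bigr => w _ do rewrite derivM derivC mulr0 addr0 deriv_prod big_distrl.
rewrite exchange_big /= horner_sum; apply: eq_bigr => e _.
rewrite expect_discrete_diff horner_sum (sum_set_split e).
apply: eq_bigr => w ew.
have offE w' : (forall i, i != e -> (i \in w') = (i \in w)) ->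
    (\prod_(i | i != e) (if i \in w' then 'X else 1 - 'X)).[p] = wt_off e p w.
  move=> w'w; rewrite horner_prod; apply: eq_bigr => i ie.
  by rewrite w'w //; case: ifP; rewrite !hornerE.
rewrite finset.setU11 (negbTE ew) derivB derivX derivC sub0r.
rewrite !hornerM !offE // => [|i /negbTE ie]; last by rewrite in_setU1 ie.
by rewrite !hornerE mulN1r mulNr mulrBr.
Qed.

End Russo.

(** * Walsh expansion on the biased cube *)

Section Fourier.
Variables (R : realType) (E : finType) (p : R).
Hypothesis p01 : 0 < p < 1.
Implicit Types (e : E) (w S : {set E}) (F : {set E} -> R).

Let c := p * (1 - p).

Let p_neq0 : p != 0.
Proof. by case/andP: p01 => /gt_eqF ->. Qed.

Let q_neq0 : 1 - p != 0.
Proof. by case/andP: p01 => _ p1; rewrite gt_eqF // subr_gt0. Qed.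

Let c_gt0 : 0 < c.
Proof. by case/andP: p01 => p0 p1; rewrite mulr_gt0 // subr_gt0. Qed.

Let c_neq0 : c != 0.
Proof. by rewrite gt_eqF. Qed.

(** The characters are not normalised: each factor has mean 0 and variance
p (1 - p) instead of 1, which avoids square roots. The power of p (1 - p) in
[energy] makes up for it. *)
Definition walsh S w : R := \prod_(e in S) ((e \in w)%:R - p).

Definition coef F S : R := expect p (fun w => F w * walsh S w).

Definition energy F S : R := coef F S ^+ 2 / c ^+ #|S|.

Lemma energy_ge0 F S : 0 <= energy F S.
Proof. by rewrite divr_ge0 ?sqr_ge0 // exprn_ge0 // ltW. Qed.

(** Completeness of the Walsh basis. The sum over all S factors over the edges,
and the factor of an edge vanishes when the two configurations differ there:
1 + (1 - p) (- p) / (p (1 - p)) = 0. *)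
Lemma reproducing w w' :
  wt p w * wt p w' * \sum_S (walsh S w * walsh S w' / c ^+ #|S|) =
  (w == w')%:R * wt p w.
Proof.
have -> : \sum_S (walsh S w * walsh S w' / c ^+ #|S|) =
    \prod_e (((e \in w)%:R - p) * ((e \in w')%:R - p) / c + 1).
  rewrite bigA_distr; apply: eq_bigr => S _.
  by rewrite -big_mkcond /= !big_split /= prodfV prodr_const.
rewrite /wt -!big_split /=.
have [<-|neq] := eqVneq w w'.
  rewrite mul1r; apply: eq_bigr => e _; rewrite /c.
  by case: ifP => ew /=; field; rewrite p_neq0 q_neq0.
rewrite mul0r.
have [e we] := neq_set_mem neq.
rewrite (bigD1 e) //= [X in X * _](_ : _ = 0) ?mul0r // /c.
by move: we; case: (e \in w); case: (e \in w') => //= _; field;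
  rewrite p_neq0 q_neq0.
Qed.

(** Writing the squared coefficients as double sums over configurations brings
out the reproducing kernel, which collapses them to the diagonal. *)
Lemma parseval F : \sum_S energy F S = expect p (fun w => F w ^+ 2).
Proof.
transitivity (\sum_w \sum_w' F w * F w' * (wt p w * wt p w' *
    \sum_S (walsh S w * walsh S w' / c ^+ #|S|))).
  under eq_bigr => S _.
    rewrite /energy /coef !/expect expr2 mulr_suml mulr_suml.
    under eq_bigr => w _ do rewrite mulr_sumr mulr_suml.
    over.
  rewrite exchange_big; apply: eq_bigr => w _ /=.
  rewrite exchange_big; apply: eq_bigr => w' _ /=.
  rewrite !mulr_sumr; apply: eq_bigr => S _; ring.
apply: eq_bigr => w _.
rewrite (bigD1 w) //= reproducing eqxx mul1r [X in _ + X]big1 ?addr0; first by ring.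
by move=> w' ww'; rewrite reproducing eq_sym (negbTE ww') mul0r mulr0.
Qed.

(** Differencing at [e] removes [e] from the characters: averaging the factor of
[e] against F leaves p (1 - p) times the difference of F at [e]. *)
Lemma coef_pivot e F S : e \notin S ->
  coef F (e |: S) = c * coef (discrete_diff e F) S.
Proof.
move=> eS; rewrite /coef !(expect_split e) mulr_sumr; apply: eq_bigr => w ew.
have wS w' : walsh (e |: S) w' = ((e \in w')%:R - p) * walsh S w'.
  by rewrite /walsh big_setU1.
have Sw : walsh S (e |: w) = walsh S w.
  apply: eq_bigr => i iS; rewrite in_setU1; case: eqVneq => // ie.
  by rewrite -ie iS in eS.
rewrite !wS finset.setU11 (negbTE ew) Sw discrete_diff_in // discrete_diff_out //.
by rewrite /= mulr1n mulr0n /c; ring.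
Qed.

(** The difference at [e] does not depend on the state of [e], and the factor of
[e] has mean 0. *)
Lemma coef_diff0 e F S : e \in S -> coef (discrete_diff e F) S = 0.
Proof.
move=> eS; rewrite /coef (expect_split e) big1 // => w ew.
rewrite discrete_diff_in // discrete_diff_out //.
have wS w' : walsh S w' = ((e \in w')%:R - p) * walsh (S :\ e) w'.
  by rewrite /walsh (big_setD1 e).
have Sw : walsh (S :\ e) (e |: w) = walsh (S :\ e) w.
  by apply: eq_bigr => i; rewrite in_setD1 in_setU1 => /andP[/negbTE ->].
by rewrite !wS finset.setU11 (negbTE ew) Sw /= mulr1n mulr0n; ring.
Qed.

(** Parseval's identity for the difference at [e], whose coefficients are given
by the two lemmas above. *)
Lemma energy_through e F :
  \sum_(S : {set E} | e \in S) energy F S =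
  c * expect p (fun w => discrete_diff e F w ^+ 2).
Proof.
rewrite -parseval mulr_sumr !(sum_set_split e) big_mkcond /= (sum_set_split e).
apply: eq_bigr => S eS; rewrite finset.setU11 (negbTE eS) addr0.
rewrite [energy (discrete_diff e F) (e |: S)]/energy coef_diff0 ?finset.setU11 //.
rewrite expr0n /= mul0r mulr0 add0r /energy coef_pivot // cardsU1 eS add1n (exprS c).
by field; rewrite c_neq0 expf_neq0.
Qed.

Lemma energy_set1 e F :
  energy F [set e]%SET = c * expect p (discrete_diff e F) ^+ 2.
Proof.
have e1 : [set e]%SET = e |: finset.set0.
  by apply/setP => x; rewrite !inE orbF.
rewrite /energy cards1 e1 coef_pivot ?finset.in_set0 //.
rewrite /coef /expect.
under eq_bigr => w _ do rewrite /walsh big_set0 mulr1.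
by field.
Qed.

Lemma energy_set0 F : energy F finset.set0 = expect p F ^+ 2.
Proof.
rewrite /energy cards0 expr0 divr1 /coef /expect.
by under eq_bigr => w _ do rewrite /walsh big_set0 mulr1.
Qed.

(** The Poincare inequality gives the variance as at most the total influence,
since nonempty sets have size at least 1. Counting singletons twice, that is
2 <= #|S| + [#|S| = 1], improves the constant to 1/2 on all but the first level
of the expansion. *)
Lemma variance_le F :
  2 * (expect p (fun w => F w ^+ 2) - expect p F ^+ 2) <=
  c * \sum_e (expect p (fun w => discrete_diff e F w ^+ 2) +
              expect p (discrete_diff e F) ^+ 2).
Proof.
rewrite -parseval -energy_set0 (bigD1 finset.set0) //= addrAC subrr add0r.
have -> : c * \sum_e (expect p (fun w => discrete_diff e F w ^+ 2) +
              expect p (discrete_diff e F) ^+ 2) =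
    \sum_(S : {set E}) \sum_e
      ((e \in S)%:R + (S == [set e]%SET)%:R) * energy F S.
  rewrite mulr_sumr exchange_big /=; apply: eq_bigr => e _.
  rewrite mulrDr -energy_through -energy_set1 big_mkcond /=.
  under [RHS]eq_bigr => S _ do rewrite mulrDl.
  rewrite big_split /=; congr (_ + _).
    by apply: eq_bigr => S _; case: ifP; rewrite ?mul1r ?mul0r.
  rewrite (bigD1 [set e]%SET) //= eqxx mul1r big1 ?addr0 // => S /negbTE ->.
  by rewrite mul0r.
(* Both sides are now sums over S, and can be compared term by term. *)
rewrite mulr_sumr [leRHS](bigD1 finset.set0) //= -[leLHS]add0r lerD //.
  by apply: sumr_ge0 => e _; rewrite mulr_ge0 ?energy_ge0 // addr_ge0.
apply: ler_sum => S S0; rewrite -mulr_suml ler_wpM2r ?energy_ge0 //.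
rewrite big_split /= -natr_sum -natr_sum -natrD ler_nat.
have -> : (\sum_e (e \in S) = #|S|)%N by rewrite -sum1_card [RHS]big_mkcond.
have [|S2] := leqP #|S| 1; last by rewrite (leq_trans S2) // leq_addr.
rewrite leq_eqVlt ltnS leqn0 cards_eq0 (negbTE S0) orbF => /cards1P[x ->].
by rewrite cards1 (bigD1 x) //= eqxx.
Qed.

End Fourier.

(** * Comparing expectations, and transporting connectivity *)

Section ExpectationOrder.
Variables (R : realType) (E : finType) (p : R).
Implicit Types (w T : {set E}) (F : {set E} -> R).

Lemma expectB F F' : expect p (fun w => F w - F' w) = expect p F - expect p F'.
Proof. by rewrite /expect -sumrB; apply: eq_bigr => w _; rewrite mulrBr. Qed.

Lemma expect_cst (k : R) : expect p (fun w : {set E} => k) = k.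
Proof. by rewrite /expect -mulr_suml sum_wt mul1r. Qed.

(** Expand the product over e of (0 or p) + (1 - p), where open edges of [T] get
weight 0: this discards exactly the configurations meeting [T]. *)
Lemma expect_disjoint T :
  expect p (fun w => [disjoint w & T]%:R) = (1 - p) ^+ #|T|.
Proof.
transitivity (\prod_e ((if e \in T then 0 else p) + (1 - p))); last first.
  rewrite -prodr_const [RHS]big_mkcond; apply: eq_bigr => e _ /=.
  by case: ifP => _; rewrite ?add0r // addrC subrK.
rewrite bigA_distr; apply: eq_bigr => w _.
have [dwT|] := boolP [disjoint w & T].
  rewrite mulr1; apply: eq_bigr => e _; case: ifP => // ew.
  by rewrite (disjointFr dwT).
rewrite -setI_eq0 => /finset.set0Pn[e]; rewrite inE => /andP[ew eT].
by rewrite mulr0 (bigD1 e) //= ew eT mul0r.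
Qed.

Hypothesis p01 : 0 <= p <= 1.

Lemma wt_ge0 w : 0 <= wt p w.
Proof.
by case/andP: p01 => p0 p1; apply: prodr_ge0 => e _; case: ifP; rewrite ?subr_ge0.
Qed.

Lemma ler_expect F F' : (forall w, F w <= F' w) -> expect p F <= expect p F'.
Proof. by move=> FF'; apply: ler_sum => w _; rewrite ler_wpM2l ?wt_ge0. Qed.

End ExpectationOrder.

Lemma wt_gt0 (R : realType) (E : finType) (p : R) (w : {set E}) :
  0 < p < 1 -> 0 < wt p w.
Proof.
by case/andP=> p0 p1; apply: prodr_gt0 => e _; case: ifP; rewrite ?subr_gt0.
Qed.

Lemma connect_homo (T T' : finType) (e : rel T) (e' : rel T') (h : T -> T') :
  (forall x y, e x y -> connect e' (h x) (h y)) ->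
  forall x y, connect e x y -> connect e' (h x) (h y).
Proof.
move=> eh x y /connectP[s]; elim: s x => [|z s IH] x /=; first by move=> _ ->.
by case/andP=> /eh xz /IH zy /zy; apply: connect_trans.
Qed.

Lemma connect_invariant (T : finType) (e : rel T) (P : pred T) :
  (forall x y, e x y -> P x -> P y) ->
  forall x y, connect e x y -> P x -> P y.
Proof.
move=> eP x y /connectP[s]; elim: s x => [|z s IH] x /=; first by move=> _ ->.
by case/andP=> /eP xz zs ys /xz; apply: IH.
Qed.

(** * Crossings of a graph *)

Section Crossing.
Variable G : ograph.
Implicit Types (x y : vert G) (e : edge G) (w : {set edge G}).

Lemma adj_in_sym w : symmetric (adj_in w).
Proof. by move=> x y; apply: eq_existsb => e; rewrite [in RHS]finset.setUC. Qed.

Lemma connect_adj_sym w : connect_sym (adj_in w).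
Proof. exact/sym_connect_sym/adj_in_sym. Qed.

Lemma adj_inP w x y :
  reflect (exists2 e, e \in w & ends e = [set x; y]%SET) (adj_in w x y).
Proof.
apply: (iffP existsP) => [[e /andP[ew /eqP xy]]|[e ew xy]]; exists e => //.
by rewrite ew xy eqxx.
Qed.

Lemma connect_adjS w w' : w \subset w' ->
  subrel (connect (adj_in w)) (connect (adj_in w')).
Proof.
move=> ww'; apply: connect_sub => x y /adj_inP[e ew xy].
by apply/connect1/adj_inP; exists e => //; apply: (fintype.subsetP ww').
Qed.

Lemma connect_ends w e x y :
  e \in w -> x \in ends e -> y \in ends e -> connect (adj_in w) x y.
Proof.
move=> ew; rewrite !inE.
have st : connect (adj_in w) (src e) (tgt e).
  by apply/connect1/adj_inP; exists e.
by move=> /orP[] /eqP-> /orP[] /eqP-> //; rewrite connect_adj_sym.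
Qed.

Lemma connect_touches w x y : x != y -> connect (adj_in w) x y ->
  exists2 e, e \in w & x \in ends e.
Proof.
move=> xy /connectP[[|z s] /= + ys]; first by rewrite ys eqxx in xy.
by case/andP=> /adj_inP[e ew exz] _; exists e; rewrite // exz !inE eqxx.
Qed.

(** The length bound is needed since the minimum in [gdist] ranges over walks
with fewer steps than there are vertices. *)
Lemma gdist_le x y (s : seq (vert G)) :
  (size s < #|vert G|)%N -> path (@adj G) x s -> last x s = y ->
  (gdist x y <= size s)%N.
Proof.
move=> lts xs ys; rewrite /gdist.
have : Ordinal lts \in index_enum 'I_#|vert G| by rewrite mem_index_enum.
elim: (index_enum _) => //= n r IH; rewrite inE big_cons => /orP[/eqP <-|nr].
  rewrite ifT ?geq_minl //; apply/existsP; exists (in_tuple s) => /=.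
  by rewrite xs ys eqxx.
by case: ifP => _; rewrite ?(leq_trans (geq_minr _ _)) ?IH.
Qed.

Lemma far_neq x y : (1 < gdist x y)%N -> x != y.
Proof.
apply: contraTneq => <-; rewrite -leqNgt.
apply: leq_trans (leq0n 1); apply: (@gdist_le x x [::]) => //.
by apply/card_gt0P; exists x.
Qed.

(** Otherwise [e] would be a walk of length 1 from [x] to [y]. *)
Lemma far_ends x y e : (1 < gdist x y)%N -> ~~ ((x \in ends e) && (y \in ends e)).
Proof.
move=> far; apply/negP => /andP[xe ye]; have xy := far_neq far.
move: far; rewrite ltnNge => /negP; apply.
apply: (@gdist_le x y [:: y]) => //=.
  by have := max_card (mem [set x; y]%SET); rewrite cards2 xy.
rewrite andbT; apply/adj_inP; exists e; rewrite ?inE //.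
move: xe ye; rewrite !inE => /orP[] /eqP xE /orP[] /eqP yE;
  rewrite xE yE ?eqxx // in xy *.
by rewrite /ends finset.setUC.
Qed.

Definition star x : {set edge G} := [set e | x \in ends e]%SET.

Lemma card_star_le x : (#|star x| <= deg x)%N.
Proof.
rewrite /deg (leq_trans _ (leq_card_setU _ _)) //; apply: subset_leq_card.
by apply/fintype.subsetP => e; rewrite !inE ![x == _]eq_sym.
Qed.

Lemma crossing_mono w w' :
  w \subset w' -> w \in crossing_event G -> w' \in crossing_event G.
Proof. by rewrite !inE => /connect_adjS; apply. Qed.

Lemma path_avoid e x s : path (@adj G) x s -> ends e \notin path_edges x s ->
  connect (adj_in (~: [set e])%SET) x (last x s).
Proof.
elim: s x => [|z s IH] x /=; first by rewrite connect0.
case/andP=> /adj_inP[i _ ixz] zs; rewrite inE negb_or => /andP[exz es].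
apply: connect_trans (IH z zs es); apply/connect1/adj_inP; exists i => //.
by rewrite !inE; apply: contraNneq exz => <-; rewrite ixz.
Qed.

(** A path without [e] survives when only [e] is closed, and [e] lies on at most
one of the two disjoint paths. *)
Lemma crossing_without e : two_edge_disjoint_paths (ga G) (gb G) ->
  (~: [set e])%SET \in crossing_event G.
Proof.
case=> s1 [s2 [[p1 l1 _] [p2 l2 _] dis]]; rewrite inE.
have [e1|e1] := boolP (ends e \in path_edges (ga G) s1).
  by rewrite -l2; apply: path_avoid => //; rewrite (disjointFr dis).
by rewrite -l1; apply: path_avoid.
Qed.

Lemma crossing_at_ends w : ga G != gb G -> w \in crossing_event G ->
  forall x, x \in [set ga G; gb G]%SET -> exists2 e, e \in w & x \in ends e.
Proof.
rewrite !inE => ab cw x; rewrite !inE => /orP[] /eqP ->.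
  exact: connect_touches cw.
by apply: (@connect_touches _ _ (ga G)); rewrite 1?eq_sym // connect_adj_sym.
Qed.

End Crossing.

(** * The sharpened Moore-Shannon inequality *)

Section CrossingProbability.
Variables (R : realType) (G : ograph).
Implicit Types (p : R) (e : edge G) (w : {set edge G}).

Definition crossing w : R := (w \in crossing_event G)%:R.

Lemma crossing_probE p : crossing_prob G p = expect p crossing.
Proof.
rewrite /crossing_prob /perc_prob big_mkcond; apply: eq_bigr => w _.
by rewrite /crossing; case: ifP => _; rewrite ?mulr1 ?mulr0.
Qed.

(** By monotonicity the difference is the indicator of [e] being pivotal. *)
Lemma crossing_diff e w : discrete_diff e crossing w =
  ((e |: w \in crossing_event G) && (w :\ e \notin crossing_event G))%:R.
Proof.
rewrite /discrete_diff /crossing.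
have : (w :\ e \in crossing_event G) -> (e |: w \in crossing_event G).
  by apply: crossing_mono; rewrite (fintype.subset_trans (subD1set _ _)) // subsetU1.
case: (_ \in _); case: (_ \in _) => /=; rewrite ?subrr ?subr0 //.
by move=> /(_ isT).
Qed.

Lemma crossing_sqr w : crossing w ^+ 2 = crossing w.
Proof. by rewrite /crossing; case: (_ \in _); rewrite ?expr1n ?expr0n. Qed.

Lemma crossing_diff_sqr e w :
  discrete_diff e crossing w ^+ 2 = discrete_diff e crossing w.
Proof. by rewrite crossing_diff; case: (_ && _); rewrite ?expr1n ?expr0n. Qed.

Hypothesis far : (1 < gdist (ga G) (gb G))%N.

(** Some distinguished vertex x is not an end of [e]. When all edges at x are
closed there is no crossing, whatever the state of [e]. *)
Lemma expect_pivotal_le p e : 0 < p < 1 ->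
  expect p (discrete_diff e crossing) <=
  1 - (1 - p) ^+ maxn (deg (ga G)) (deg (gb G)).
Proof.
move=> p01; case/andP: (p01) => p0 p1.
have [x xab xe] : exists2 x, x \in [set ga G; gb G]%SET & x \notin ends e.
  have := far_ends e far; rewrite negb_and => /orP[] xe.
    by exists (ga G); rewrite // !inE eqxx.
  by exists (gb G); rewrite // !inE eqxx orbT.
have xdeg : (#|star x| <= maxn (deg (ga G)) (deg (gb G)))%N.
  by rewrite leq_max; move: xab; rewrite !inE => /orP[] /eqP ->;
    rewrite card_star_le ?orbT.
apply: (@le_trans _ _ (1 - (1 - p) ^+ #|star x|)); last first.
  by rewrite lerB // ler_wiXn2l //; lra.
rewrite -expect_disjoint.
rewrite (_ : 1 - _ = expect p (fun w => 1 - [disjoint w & star x]%:R)); last first.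
  by rewrite expectB expect_cst.
apply: ler_expect => [|w]; first by rewrite !ltW.
have [dis|] := boolP [disjoint w & star x]; last first.
  by rewrite crossing_diff subr0 lern1 leq_b1.
rewrite subrr crossing_diff (_ : _ && _ = false) //.
apply/negP => /andP[/(crossing_at_ends (far_neq far))/(_ x xab)[i + xi] _].
rewrite in_setU1 => /orP[/eqP ie|iw]; first by rewrite -ie xi in xe.
by have := disjointFr dis iw; rewrite inE xi.
Qed.

(** The expected number of pivotal edges: the derivative of the crossing
probability, by Russo's formula. *)
Definition pivotal_sum (p : R) : R := \sum_e expect p (discrete_diff e crossing).

(** Being an indicator, the crossing event has variance f (1 - f), and the
difference at each edge equals its own square. The bound on the probability
that an edge is pivotal then absorbs the squares in [variance_le]. *)
Lemma sharp_moore_shannon p : 0 < p < 1 ->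
  crossing_prob G p * (1 - crossing_prob G p) <=
  p * (1 - p) * pivotal_sum p *
    (1 - 2^-1 * (1 - p) ^+ maxn (deg (ga G)) (deg (gb G))).
Proof.
move=> p01; rewrite crossing_probE; set f := expect p crossing.
have c0 : 0 <= p * (1 - p) by case/andP: p01 => p0 p1; rewrite mulr_ge0 ?subr_ge0 ?ltW.
have := variance_le p01 crossing.
rewrite (_ : expect p (fun w => crossing w ^+ 2) = f); last first.
  by apply: eq_bigr => w _; rewrite crossing_sqr.
set S := \sum_e _ => var.
have SP : S <= pivotal_sum p *
    (2 - (1 - p) ^+ maxn (deg (ga G)) (deg (gb G))).
  rewrite /S /pivotal_sum mulr_suml; apply: ler_sum => e _.
  rewrite (_ : expect p _ = expect p (discrete_diff e crossing)); last first.
    by apply: eq_bigr => w _; rewrite crossing_diff_sqr.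
  have pe := expect_pivotal_le e p01.
  have pe0 : 0 <= expect p (discrete_diff e crossing).
    rewrite -(expect_cst (edge G) p 0); apply: ler_expect => [|w].
      by case/andP: p01 => p0 p1; rewrite !ltW.
    by rewrite crossing_diff.
  by have := ler_wpM2l pe0 pe; rewrite expr2; lra.
have := ler_wpM2l c0 SP; rewrite mulrA.
move: ((1 - p) ^+ _) var => D; rewrite -/f => var le.
suff : 2 * (f * (1 - f)) <= 2 * (p * (1 - p) * pivotal_sum p * (1 - 2^-1 * D)).
  by rewrite ler_pM2l.
rewrite (_ : 2 * (f * (1 - f)) = 2 * (f - f ^+ 2)); last by ring.
rewrite (_ : 2 * (_ * _) = p * (1 - p) * pivotal_sum p * (2 - D)); last by field.
exact: le_trans le.
Qed.

(** At p = 0 only the empty configuration has weight, and a single open edge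
cannot touch both distinguished vertices. *)
Lemma pivotal_sum0 : pivotal_sum 0 = 0.
Proof.
apply: big1 => e _; rewrite /expect (bigD1 finset.set0) //= big1 => [|w w0].
  rewrite addr0 crossing_diff [_ && _](_ : _ = false) ?mulr0 //; apply/negP => /andP[+ _].
  rewrite finset.setU0 => /(crossing_at_ends (far_neq far)) touch.
  have /negP := far_ends e far; apply; apply/andP; split.
    by have [|i /set1P ->] := touch (ga G); rewrite // !inE eqxx.
  by have [|i /set1P ->] := touch (gb G); rewrite // !inE eqxx orbT.
have /finset.set0Pn[i iw] := w0.
by rewrite /wt (bigD1 i) //= iw !mul0r.
Qed.

(** At p = 1 only the full configuration has weight, and it still crosses when
one edge is closed. *)
Lemma pivotal_sum1 : two_edge_disjoint_paths (ga G) (gb G) -> pivotal_sum 1 = 0.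
Proof.
move=> paths; apply: big1 => e _.
rewrite /expect (bigD1 finset.setT) //= big1 => [|w wT].
  rewrite addr0 crossing_diff [_ && _](_ : _ = false) ?mulr0 //.
  by rewrite finset.setTD crossing_without // andbF.
have [i] := neq_set_mem wT; rewrite finset.in_setT eqb_id => iw.
by rewrite /wt (bigD1 i) //= (negbTE iw) subrr !mul0r.
Qed.

Lemma crossing_prob_ge0 p : 0 <= p <= 1 -> 0 <= crossing_prob G p.
Proof.
move=> p01; rewrite crossing_probE -(expect_cst (edge G) p 0).
by apply: ler_expect.
Qed.

Lemma crossing_prob_le1 p : 0 <= p <= 1 -> crossing_prob G p <= 1.
Proof.
move=> p01; rewrite crossing_probE -[leRHS](expect_cst (edge G) p 1).
by apply: ler_expect => // w; rewrite lern1 leq_b1.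
Qed.

Lemma set0_not_crossing : finset.set0 \notin crossing_event G.
Proof.
apply/negP => /(crossing_at_ends (far_neq far)) /(_ (ga G)).
by rewrite !inE eqxx => /(_ isT)[e]; rewrite inE.
Qed.

Lemma crossing_prob_lt1 p : 0 < p < 1 -> crossing_prob G p < 1.
Proof.
move=> p01; rewrite -subr_gt0 crossing_probE.
rewrite (_ : 1 - _ = expect p (fun w => 1 - crossing w)); last first.
  by rewrite expectB expect_cst.
rewrite /expect (bigD1 finset.set0) //= ltr_wpDr //.
  apply: sumr_ge0 => w _; rewrite mulr_ge0 //.
    by rewrite ltW ?wt_gt0.
  by rewrite subr_ge0 lern1 leq_b1.
by rewrite /crossing (negbTE set0_not_crossing) subr0 mulr1 wt_gt0.
Qed.

Lemma crossing_prob_gt0 p : connected_graph G -> 0 < p < 1 ->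
  0 < crossing_prob G p.
Proof.
move=> conn p01; rewrite crossing_probE.
rewrite /expect (bigD1 finset.setT) //= ltr_wpDr //.
  by apply: sumr_ge0 => w _; rewrite mulr_ge0 // ltW ?wt_gt0.
rewrite /crossing (_ : finset.setT \in _); first by rewrite mulr1 wt_gt0.
by rewrite inE; apply: conn.
Qed.

Lemma crossing_prob0 : crossing_prob G (0 : R) = 0.
Proof.
rewrite crossing_probE /expect big1 // => w _.
have [->|/finset.set0Pn[e ew]] := eqVneq w finset.set0.
  by rewrite /crossing (negbTE set0_not_crossing) mulr0.
by rewrite /wt (bigD1 e) //= ew !mul0r.
Qed.

Lemma crossing_prob1 : connected_graph G -> crossing_prob G (1 : R) = 1.
Proof.
move=> conn; rewrite crossing_probE -[RHS](expect_cst (edge G) 1).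
apply: eq_bigr => w _.
have [->|wT] := eqVneq w finset.setT.
  by rewrite /crossing inE [connect _ _ _]conn.
have [e] := neq_set_mem wT; rewrite finset.in_setT eqb_id => ew.
by rewrite /wt (bigD1 e) //= (negbTE ew) subrr !mul0r.
Qed.

Lemma is_derive_crossing_prob (p : R) :
  is_derive p 1 (@crossing_prob G R) (pivotal_sum p).
Proof.
rewrite (_ : (@crossing_prob G R) = horner (expect_poly crossing)).
  by rewrite /pivotal_sum -russo; apply: is_derive_poly.
by apply/funext => x; rewrite horner_expect crossing_probE.
Qed.

End CrossingProbability.

(** * Replacing edges composes crossing probabilities *)

Section Blocks.
Variables (R : realType) (E D : finType).
Implicit Types (w : {set E * D}) (v : {set E}).

Definition block w (e : E) : {set D} := [set d | (e, d) \in w]%SET.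

Definition blocks_in (B : {set {set D}}) w : {set E} :=
  [set e | block w e \in B]%SET.

Lemma wt_blocks (p : R) w : wt p w = \prod_e wt p (block w e).
Proof.
rewrite /wt pair_bigA /=; apply: eq_bigr => -[e d] _ /=.
by rewrite inE.
Qed.

(** The weight of v when an edge is open with the probability of B, rewritten as
a sum over independent blocks h whose pattern of membership in B is v. *)
Lemma wt_expect (p : R) (B : {set {set D}}) v :
  wt (expect p (fun u : {set D} => (u \in B)%:R)) v =
  \sum_(h : {ffun E -> {set D}})
    \prod_e (wt p (h e) * ((h e \in B) == (e \in v))%:R).
Proof.
rewrite -(bigA_distr_bigA (fun e (u : {set D}) =>
  wt p u * ((u \in B) == (e \in v))%:R)).
apply: eq_bigr => e _; case: ifP => _.
  by apply: eq_bigr => u _; rewrite eqb_id.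
rewrite -[X in X - _](expect_cst D p) -expectB; apply: eq_bigr => u _.
by case: (u \in B); rewrite /= ?subrr ?subr0.
Qed.

(** A configuration on E * D is a family of independent blocks. Grouping the
families by the set of indices whose block lies in B leaves a product weight on
E again, with parameter P(B). *)
Lemma expect_blocks (p : R) (B : {set {set D}}) (g : {set E} -> R) :
  expect p (fun w => g (blocks_in B w)) =
  expect (expect p (fun u : {set D} => (u \in B)%:R)) g.
Proof.
rewrite [RHS]/expect.
under [RHS]eq_bigr => v _ do rewrite wt_expect mulr_suml.
rewrite exchange_big /= [LHS](reindex (fun h : {ffun E -> {set D}} =>
  [set ed | ed.2 \in h ed.1]%SET)) /=; last first.
  exists (fun w => [ffun e => block w e]) => [h _|w _].
    by apply/ffunP => e; apply/setP => d; rewrite ffunE !inE.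
  by apply/setP => -[e d]; rewrite !inE ffunE inE.
apply: eq_bigr => h _.
have hE e : block [set ed | ed.2 \in h ed.1]%SET e = h e.
  by apply/setP => d; rewrite !inE.
rewrite wt_blocks (bigD1 [set e | h e \in B]%SET) //= [X in _ + X]big1 => [|v vB].
  rewrite addr0 big_split /= [X in _ = _ * X * _]big1 ?mulr1 => [|e _].
    congr (_ * g _); first by apply: eq_bigr => e _; rewrite hE.
    by apply/setP => e; rewrite !inE hE.
  by rewrite inE eqxx.
have [e] := neq_set_mem vB; rewrite inE eq_sym => ve.
by rewrite (bigD1 e) //= (negbTE ve) mulr0 !mul0r.
Qed.

End Blocks.

Section ReplaceEdges.
Variables G H : ograph.
Hypothesis abH : ga H != gb H.
Implicit Types (e : edge G) (d : edge H) (w : {set edge G * edge H}).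

Local Notation GH := (replace_edges G H).

Lemma glue_ga e : Defs.glue e (ga H) = inl (src e).
Proof. by rewrite /Defs.glue insubF ?eqxx. Qed.

Lemma glue_gb e : Defs.glue e (gb H) = inl (tgt e).
Proof. by rewrite /Defs.glue insubF ?eqxx ?andbF // eq_sym (negbTE abH). Qed.

Lemma ends_replace e d :
  @ends GH (e, d) = [set Defs.glue e v | v in ends d]%SET.
Proof. by rewrite /ends imsetU1 imset_set1. Qed.

Let cluster w : pred (vert G) :=
  connect (@adj_in G (blocks_in (crossing_event H) w)) (ga G).

(** The set that the cluster of the starting vertex should be if only crossed
blocks connect vertices of G: inside a copy of H, a vertex is reached from one
of the two attaching vertices, which itself is reached in G. Being closed under
open edges, it contains the cluster. *)
Definition reached w (z : vert GH) : bool :=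
  match z with
  | inl x => cluster w x
  | inr (e, u) => cluster w (src e) && connect (adj_in (block w e)) (ga H) (val u)
               || cluster w (tgt e) && connect (adj_in (block w e)) (gb H) (val u)
  end.

(** One formula for all vertices of a copy of H. At an attaching vertex it has
an extra disjunct, entering through the other one; this is harmless because the
block is then crossed and both ends are in the same cluster. *)
Lemma reached_glue w e v : reached w (Defs.glue e v) =
  cluster w (src e) && connect (adj_in (block w e)) (ga H) v
  || cluster w (tgt e) && connect (adj_in (block w e)) (gb H) v.
Proof.
have cross : connect (adj_in (block w e)) (ga H) (gb H) -> cluster w (src e) = cluster w (tgt e).
  move=> ab; have st : connect
      (@adj_in G (blocks_in (crossing_event H) w)) (src e) (tgt e).
    by apply: (@connect_ends _ _ e); rewrite !inE ?eqxx ?orbT.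
  by apply/idP/idP => /connect_trans; apply; rewrite // connect_adj_sym.
have [->|va] := eqVneq v (ga H).
  rewrite glue_ga connect0 andbT /=; case: (boolP (cluster w (tgt e))) => /=.
    rewrite connect_adj_sym => te; apply/idP/orP => [|[//|/cross ->//]].
    by left.
  by rewrite orbF.
have [->|vb] := eqVneq v (gb H).
  rewrite glue_gb connect0 andbT /=; case: (boolP (cluster w (src e))) => //= se.
  by apply/idP/orP => [|[/cross <-//|//]]; right.
by rewrite /Defs.glue insubT ?va ?vb.
Qed.

Lemma reached_step w (z z' : vert GH) :
  adj_in (G := GH) w z z' -> reached w z -> reached w z'.
Proof.
case/adj_inP=> -[e d] edw; rewrite ends_replace => zz'.
have : z \in [set Defs.glue e v | v in ends d]%SET by rewrite zz' !inE eqxx.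
have : z' \in [set Defs.glue e v | v in ends d]%SET by rewrite zz' !inE eqxx orbT.
case/imsetP=> v' v'd -> /imsetP[v vd ->]; rewrite !reached_glue.
have vv' : connect (adj_in (block w e)) v v'.
  by apply: connect_ends vd v'd; rewrite inE.
by move=> /orP[] /andP[-> cv]; rewrite (connect_trans cv vv') ?orbT.
Qed.

(** From a crossing of the new graph, the invariant [reached] produces one of G;
conversely each crossed block is a path between the ends of its edge. *)
Lemma crossing_replace w : (w \in crossing_event GH) =
  (blocks_in (crossing_event H) w \in crossing_event G).
Proof.
rewrite !inE; apply/idP/idP => [|].
  by move/(connect_invariant (reached_step (w := w))); apply; exact: connect0.
apply: (connect_homo (h := inl)) => x y /adj_inP[e]; rewrite !inE => ew xy.
have st : connect (@adj_in GH w) (inl (src e)) (inl (tgt e)).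
  rewrite -glue_ga -glue_gb; apply: connect_homo ew => u v /adj_inP[d].
  rewrite inE => edw uv; apply/connect1/adj_inP; exists (e, d) => //.
  by rewrite ends_replace uv imsetU1 imset_set1.
have : x \in ends e by rewrite xy !inE eqxx.
have : y \in ends e by rewrite xy !inE eqxx orbT.
rewrite !inE => /orP[] /eqP -> /orP[] /eqP -> //.
by rewrite -(@connect_adj_sym GH w (inl (src e)) (inl (tgt e))).
Qed.

Lemma crossing_prob_replace (R : realType) (p : R) :
  crossing_prob GH p = crossing_prob G (crossing_prob H p).
Proof.
rewrite !crossing_probE -expect_blocks; apply: eq_bigr => w _.
by rewrite /crossing crossing_replace.
Qed.

End ReplaceEdges.

Lemma crossing_prob_single_edge (R : realType) (p : R) :
  crossing_prob single_edge p = p.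
Proof.
rewrite crossing_probE (expect_split (tt : edge single_edge)).
rewrite (big_pred1 finset.set0) => [|w]; last first.
  rewrite -[RHS]negbK; congr (~~ _); apply/idP/finset.set0Pn => [tw|[[]]//].
  by exists tt.
rewrite /wt_off big_pred0 => [|[]//]; rewrite mul1r.
have -> : crossing (G := single_edge) R (tt |: finset.set0) = 1.
  rewrite /crossing inE connect1 //; apply/adj_inP; exists tt => //.
  by rewrite !inE.
have -> : crossing (G := single_edge) R finset.set0 = 0.
  rewrite /crossing inE; have [/connect_touches|//] := boolP (connect _ _ _).
  by case=> // e; rewrite inE.
by rewrite mulr1 mulr0 addr0.
Qed.

Lemma crossing_prob_hier (R : realType) (G : ograph) k (p : R) :
  ga G != gb G ->
  crossing_prob (hier G k) p = iter k (@crossing_prob G R) p.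
Proof.
move=> ab; elim: k p => [|k IH] p /=; first exact: crossing_prob_single_edge.
by rewrite crossing_prob_replace // IH -iterSr.
Qed.

(** * A sharp threshold has a single interior fixed point *)

Local Open Scope classical_set_scope.

Section OneCrossing.
Variables (R : realType) (f df : R -> R).
Hypothesis f_derive : forall x : R, is_derive x 1 f (df x).

Let f_continuous : continuous f.
Proof.
by move=> x; apply/differentiable_continuous/derivable1_diffP; case: (f_derive x).
Qed.

(** A zero derivative, in the only form that is used: near [a] the increments
of f are smaller than those of the identity. *)
Lemma flat_below_slope1 (a : R) : df a = 0 ->
  exists2 e, 0 < e & forall h, `|h| < e -> h != 0 -> `|f (h + a) - f a| < `|h|.
Proof.
move=> dfa0; have [fa fd] := f_derive a.
have : h^-1 *: (f (h *: 1 + a) - f a) @[h --> 0^'] --> 'D_1 f a by exact: fa.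
rewrite fd dfa0 => /cvgrPdist_lt /(_ 1 ltr01) [e /= e0 He]; exists e => // h he h0.
have := He h; rewrite /= sub0r normrN => /(_ he h0).
rewrite sub0r normrN normrZ normfV -[h *: 1]/(h * 1) mulr1.
by rewrite mulrC ltr_pdivrMr ?normr_gt0 // mul1r.
Qed.

(** Flatness puts f below the diagonal just after 0, above it just before 1. *)
Lemma exists_fixpoint : f 0 = 0 -> f 1 = 1 -> df 0 = 0 -> df 1 = 0 ->
  exists2 c, 0 < c < 1 & f c = c.
Proof.
move=> f0 f1 d0 d1.
have [e e0 He] := flat_below_slope1 d0.
have [e' e'0 He'] := flat_below_slope1 d1.
(* The factor 1/4 makes h small for both ends and h < 1 - h. *)
pose h := Num.min (Num.min e e') 1 / 4.
have m0 : 0 < Num.min (Num.min e e') 1 by rewrite !lt_min e0 e'0 ltr01.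
have me : Num.min (Num.min e e') 1 <= e by rewrite !ge_min lexx.
have me' : Num.min (Num.min e e') 1 <= e' by rewrite !ge_min lexx orbT.
have m1 : Num.min (Num.min e e') 1 <= 1 by rewrite !ge_min lexx orbT.
have h0 : 0 < h by rewrite /h; lra.
have [he he' h1] : [/\ h < e, h < e' & h < 1/2] by split; rewrite /h; lra.
have fh : f h < h.
  have := He h; rewrite gtr0_norm // addr0 f0 subr0 => /(_ he).
  by rewrite gt_eqF // => /(_ isT); apply: le_lt_trans; rewrite ler_norm.
have f1h : 1 - h < f (1 - h).
  have := He' (- h); rewrite normrN gtr0_norm // f1 => /(_ he').
  rewrite oppr_eq0 gt_eqF // => /(_ isT); rewrite (addrC (- h)) ltr_norml => /andP[]; lra.
have [|||c] := @IVT R (fun x => f x - x) h (1 - h) 0.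
- lra.
- by apply: continuous_subspaceT => x; apply: continuousB => //; exact: f_continuous.
- by rewrite ge_min le_max; apply/andP; split; apply/orP; [left|right]; lra.
rewrite in_itv /= => /andP[hc ch] /eqP; rewrite subr_eq0 => /eqP fc.
by exists c => //; lra.
Qed.

Definition odds_ratio x : R := f x * (1 - x) / ((1 - f x) * x).

Hypothesis f_open : forall x : R, 0 < x < 1 -> 0 < f x < 1.
Hypothesis f_steep : forall x : R, 0 < x < 1 -> f x * (1 - f x) < x * (1 - x) * df x.

(** The numerator u' v - u v' of the quotient rule collapses to
x (1 - x) f' - f (1 - f), the difference of the two sides of [f_steep]. *)
Lemma is_derive_odds_ratio (x : R) : 0 < x < 1 -> is_derive x 1 odds_ratio
  ((x * (1 - x) * df x - f x * (1 - f x)) / ((1 - f x) * x) ^+ 2).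
Proof.
move=> x01; have /andP[fx0 fx1] := f_open x01.
have x0 : x != 0 by lra.
have fx : 1 - f x != 0 by lra.
have cst1 : is_derive x (1 : R) (cst (1 : R)) (0 : R) by exact: is_derive_cst.
have id1 : is_derive x (1 : R) (@id R) (1 : R) by exact: is_derive_id.
have num := is_deriveM (f_derive x) (is_deriveB cst1 id1).
have den := is_deriveM (is_deriveB cst1 (f_derive x)) id1.
have den0 : ((cst 1 - f) * id : R -> R) x != 0 by rewrite mulf_neq0.
apply: (is_derive_eq (is_deriveM num (is_deriveV den0 den))).
rewrite /= !fctE /GRing.scale /=.
field; by rewrite x0 fx.
Qed.

Lemma odds_ratio_incr (x y : R) :
  0 < x -> x < y -> y < 1 -> odds_ratio x < odds_ratio y.
Proof.
move=> x0 xy y1.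
have D (z : R) : z \in `[x, y]%R -> is_derive z 1 odds_ratio
  ((z * (1 - z) * df z - f z * (1 - f z)) / ((1 - f z) * z) ^+ 2).
  by rewrite in_itv /= => /andP[xz zy]; apply: is_derive_odds_ratio; lra.
have Do z : z \in `]x, y[%R -> z \in `[x, y]%R.
  by rewrite !in_itv /= => /andP[/ltW -> /ltW ->].
have cont : {within `[x, y], continuous odds_ratio}.
  by apply: derivable_within_continuous => z /D [].
have [c cxy E] := MVT xy (fun z zxy => D z (Do z zxy)) cont.
rewrite -subr_gt0 E mulr_gt0 ?subr_gt0 //.
move: cxy; rewrite in_itv /= => /andP[xc cy].
have c01 : 0 < c < 1 by lra.
have /andP[fc0 fc1] := f_open c01.
rewrite divr_gt0 ?subr_gt0 ?f_steep // exprn_gt0 // mulr_gt0 ?subr_gt0 //.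
by case/andP: c01.
Qed.

Lemma odds_ratio_lt1 (x : R) : 0 < x < 1 -> (odds_ratio x < 1) = (f x < x).
Proof.
move=> x01; have /andP[fx0 fx1] := f_open x01; have /andP[x0 x1] := x01.
rewrite /odds_ratio ltr_pdivrMr ?mulr_gt0 ?subr_gt0 // mul1r.
by rewrite mulrBr mulrBl mulr1 mul1r ltrD2r.
Qed.

Lemma odds_ratio_gt1 (x : R) : 0 < x < 1 -> (1 < odds_ratio x) = (x < f x).
Proof.
move=> x01; have /andP[fx0 fx1] := f_open x01; have /andP[x0 x1] := x01.
rewrite /odds_ratio ltr_pdivlMr ?mulr_gt0 ?subr_gt0 // mul1r.
by rewrite mulrBr mulrBl mulr1 mul1r ltrD2r.
Qed.

(** The odds ratio is compared with its value 1 at the fixed point. *)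
Lemma single_crossing (c : R) : 0 < c < 1 -> f c = c ->
  (forall x, 0 < x < c -> f x < x) /\ (forall x, c < x < 1 -> x < f x).
Proof.
move=> c01 fc; have /andP[c0 c1] := c01.
have rc : odds_ratio c = 1.
  by rewrite /odds_ratio fc (mulrC c) divff // mulf_neq0 // ?subr_eq0 ?gt_eqF.
split=> x /andP[x0 x1].
  by rewrite -odds_ratio_lt1 ?x0 ?(lt_trans x1) // -rc odds_ratio_incr.
by rewrite -odds_ratio_gt1 ?x1 ?(lt_trans c0) // -rc odds_ratio_incr.
Qed.

End OneCrossing.

(** * Iterating the crossing function *)

Section Iteration.
Variables (R : realType) (f : R -> R) (c : R).
Hypothesis f_continuous : continuous f.
Hypothesis c01 : 0 < c < 1.
Hypothesis f01 : forall x, 0 <= x <= 1 -> 0 <= f x <= 1.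
Hypothesis f0 : f 0 = 0.
Hypothesis f1 : f 1 = 1.
Hypothesis f_below : forall x, 0 < x < c -> f x < x.
Hypothesis f_above : forall x, c < x < 1 -> x < f x.

(** The iterates decrease, so they converge to a fixed point of f, and 0 is the
only one in [0, c). *)
Lemma iter_to_0 p : 0 <= p < c -> iter k f p @[k --> \oo] --> (0 : R).
Proof.
move=> /andP[p0 pc]; have /andP[c0 c1] := c01.
have f_le x : 0 <= x < c -> 0 <= f x <= x.
  move=> /andP[]; rewrite le_eqVlt => /orP[/eqP <- _|x0 xc].
    by rewrite f0 lexx.
  have /andP[-> _] /= : 0 <= f x <= 1 by apply: f01; lra.
  by rewrite ltW // f_below // x0.
pose u k := iter k f p.
have u_in k : 0 <= u k < c.
  elim: k => [|k IH] /=; first by rewrite p0.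
  have /andP[-> fk] := f_le _ IH; case/andP: IH => _; exact: le_lt_trans.
have u_decr : nonincreasing_seq u.
  by apply/nonincreasing_seqP => k; case/andP: (f_le _ (u_in k)).
have u_cvg : cvgn u.
  apply: nonincreasing_is_cvgn => //; exists 0 => _ [k _ <-].
  by case/andP: (u_in k).
have l0 : 0 <= limn u by apply: limr_ge => //; near=> k; case/andP: (u_in k).
have lp : limn u <= p := nonincreasing_cvgn_ge u_decr u_cvg 0.
have fl : f (limn u) = limn u.
  have s1 : u k.+1 @[k --> \oo] --> limn u by rewrite cvg_shiftS.
  have s2 : u k.+1 @[k --> \oo] --> f (limn u).
    exact: (continuous_cvg _ (@f_continuous (limn u)) u_cvg).
  exact: (cvg_unique _ s2 s1).
have [l_gt0|l_le0] := ltP 0 (limn u).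
  by have := @f_below (limn u); rewrite fl ltxx l_gt0 (le_lt_trans lp pc) => /(_ isT).
suff <- : limn u = 0 by exact: u_cvg.
by apply/eqP; rewrite eq_le l_le0.
Unshelve. all: by end_near. Qed.

(** Above c the iterates never fall below their starting point. *)
Lemma iter_away_from_0 p : c < p <= 1 -> ~ iter k f p @[k --> \oo] --> (0 : R).
Proof.
move=> /andP[cp p1] u0; have /andP[c0 c1] := c01.
have u_in k : p <= iter k f p <= 1.
  elim: k => [|k /andP[IH IH1]] /=; first by rewrite lexx.
  have /andP[_ -> /[!andbT]] : 0 <= f (iter k f p) <= 1 by apply: f01; lra.
  apply: (le_trans IH); move: IH1; rewrite le_eqVlt => /orP[/eqP ->|IH1].
    by rewrite f1.
  by rewrite ltW // f_above // IH1 (lt_le_trans cp).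
have : p <= limn (fun k => iter k f p).
  apply: limr_ge; first by apply/cvg_ex; exists 0.
  by near=> k; case/andP: (u_in k).
by rewrite (cvg_lim _ u0) //; lra.
Unshelve. all: by end_near. Qed.

(** The set contains [0, c) and nothing above c. *)
Lemma threshold_sup :
  c = sup [set p : R | 0 <= p <= 1 /\ iter k f p @[k --> \oo] --> (0 : R)].
Proof.
have /andP[c0 c1] := c01.
set S := [set p | _]; have Sc : ubound S c.
  move=> p [/andP[p0 p1] u0]; rewrite leNgt; apply/negP => cp.
  by apply: (@iter_away_from_0 p) u0; rewrite cp.
have below p : 0 <= p < c -> S p.
  by move=> p0c; split; [lra | exact: iter_to_0].
have S0 : S 0 by apply: below; rewrite lexx.
apply/eqP; rewrite eq_le ge_sup //; last by exists 0.
rewrite andbT leNgt; apply/negP => sc.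
have s0 : 0 <= sup S by apply: ub_le_sup => //; exists c.
have : (sup S + c) / 2 <= sup S.
  by apply: ub_le_sup; [exists c | apply: below; lra].
lra.
Qed.

End Iteration.

Theorem theorem3p1 (R : realType) (G1 : ograph)
    (hsimple : simple_graph G1) (hconn : connected_graph G1)
    (hdist : (1 < gdist (ga G1) (gb G1))%N)
    (hpaths : two_edge_disjoint_paths (ga G1) (gb G1)) :
  let f_ (k : nat) (p : R) : R := crossing_prob (hier G1 k) p in
  let f : R -> R := f_ 1%N in
  exists pstar : R,
    [/\ (* (a) *)
        0 < pstar < 1 /\
        (forall p : R, 0 <= p <= 1 ->
          (f p = p <-> [\/ p = 0, p = 1 | p = pstar])),
        (* (b) *)
        [/\ derivable f 0 1, derive1 f 0 = 0, derivable f 1 1 & derive1 f 1 = 0],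
        (let bound : R :=
           (1 - 2^-1 * (1 - pstar)
              ^+ maxn (deg (ga G1)) (deg (gb G1)))^-1 in
         [/\ derivable f pstar 1, derive1 f pstar >= bound & bound > 1])
      & (* (c) *)
        pstar = sup [set p : R | 0 <= p <= 1 /\
                       f_ k p @[k --> \oo] --> (0 : R)]].
Proof.
move=> f_ f.
pose g := @crossing_prob G1 R; pose dg := @pivotal_sum R G1.
have f_iter k : f_ k = iter k g.
  by apply/funext => p; rewrite /f_ crossing_prob_hier ?(far_neq hdist).
have -> : f = g by exact: f_iter 1%N.
have g' (p : R) : is_derive p 1 g (dg p) := is_derive_crossing_prob G1 p.
have g_continuous : continuous g.
  move=> x; apply/differentiable_continuous/derivable1_diffP.
  by case: (g' x).
have g0 : g 0 = 0 by exact: crossing_prob0.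
have g1 : g 1 = 1 by exact: crossing_prob1.
have dg0 : dg 0 = 0 by exact: pivotal_sum0.
have dg1 : dg 1 = 0 by exact: pivotal_sum1.
have g01 p : 0 <= p <= 1 -> 0 <= g p <= 1.
  by move=> p01; rewrite crossing_prob_ge0 // crossing_prob_le1.
have g_open p : 0 < p < 1 -> 0 < g p < 1.
  by move=> p01; rewrite crossing_prob_gt0 // crossing_prob_lt1.
pose delta p : R := 2^-1 * (1 - p) ^+ maxn (deg (ga G1)) (deg (gb G1)).
have delta_in p : 0 < p < 1 -> 0 < delta p < 1.
  case/andP=> p0 p1; have q0 : 0 < 1 - p by rewrite subr_gt0.
  have : 0 < (1 - p) ^+ maxn (deg (ga G1)) (deg (gb G1)) by rewrite exprn_gt0.
  have : (1 - p) ^+ maxn (deg (ga G1)) (deg (gb G1)) <= 1.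
    by rewrite exprn_ile1 // ?ltW //; lra.
  by rewrite /delta; lra.
have sharp p : 0 < p < 1 -> g p * (1 - g p) <= p * (1 - p) * dg p * (1 - delta p).
  exact: sharp_moore_shannon.
have steep p : 0 < p < 1 -> g p * (1 - g p) < p * (1 - p) * dg p.
  move=> p01; have /andP[d0 d1] := delta_in p p01.
  have /andP[gp0 gp1] := g_open p p01.
  have v0 : 0 < g p * (1 - g p) by rewrite mulr_gt0 // subr_gt0.
  have := lt_le_trans v0 (sharp p p01).
  rewrite pmulr_lgt0 ?subr_gt0 // => K0.
  by apply: le_lt_trans (sharp p p01) _; rewrite gtr_pMr // gtrBl.
have [c c01 gc] := exists_fixpoint g' g0 g1 dg0 dg1.
have [below above] := single_crossing g' g_open steep c01 gc.
have /andP[c0 c1] := c01.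
exists c; split.
- split=> // p /andP[p0 p1]; split=> [gp|[]->] //.
  have [pc|cp|->] := ltgtP p c; last by constructor 3.
    move: p0; rewrite le_eqVlt => /orP[/eqP <-|p0]; first by constructor 1.
    by have := below p; rewrite gp ltxx p0 pc => /(_ isT).
  move: p1; rewrite le_eqVlt => /orP[/eqP ->|p1]; first by constructor 2.
  by have := above p; rewrite gp ltxx p1 cp => /(_ isT).
- have [d0 e0] := g' 0; have [d1 e1] := g' 1.
  by split; rewrite ?derive1E ?e0 ?e1.
- have [dc ec] := g' c; rewrite -/(delta c).
  have /andP[del0 del1] := delta_in c c01.
  have pos : 0 < 1 - delta c by rewrite subr_gt0.
  split=> //; last by rewrite invf_gt1 // gtrBl.
  rewrite derive1E ec -[_^-1]mul1r ler_pdivrMr //.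
  have c_var : 0 < c * (1 - c) by rewrite mulr_gt0 // subr_gt0.
  by rewrite -(ler_pM2l c_var) mulr1 mulrA; have := sharp c c01; rewrite gc.
- have -> : f_ = fun k => iter k g by apply/funext.
  exact: threshold_sup.
Qed.
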